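(* Let $(M^6,g,\phi)$ be an $\mathrm{SU}(3)$-manifold with intrinsic endomorphism $S$ and intrinsic 1-form $\eta$. The intrinsic torsion of the $\mathrm{SU}(3)$-structure is $$\Gamma=S\lrcorner\psi_\phi-\tfrac23\,\eta\otimes\omega,$$ where $(S\lrcorner\psi_\phi)(X,Y,Z):=\psi_\phi(S(X),Y,Z)$.
   Context: Conventions. $(M^6,g)$ is an oriented Riemannian spin manifold with a unit section $\phi$ of its real rank-8 spinor bundle $\Sigma$ (associated with the real 8-dimensional representation of the Clifford algebra of $\mathbb{R}^6$, $X^2=-|X|^2$), with inner product $(\cdot,\cdot)$ for which vectors act skew-symmetrically; Clifford multiplication is juxtaposition, forms act by $e_{i_1}\wedge\dots\wedge e_{i_k}\mapsto e_{i_1}\cdots e_{i_k}$. $\nabla$ is the Levi-Civita connection and its lift. $j:=e_1\cdots e_6$ satisfies $j^2=-1$ and anticommutes with vectors. The spinor $\phi$ determines: $J$ by $(JX)\phi=j(X\phi)$; $\omega(X,Y)=g(X,JY)$; $\psi_\phi(X,Y,Z)=-(XYZ\phi,\phi)$; and the unique one-form $\eta$ and endomorphism field $S$ with $\nabla_X\phi=\eta(X)j(\phi)+S(X)\phi$. Intrinsic torsion. Identify 2-forms with skew endomorphisms by $g(A(Y),Z)=\alpha(Y,Z)$, and let $\mathfrak{su}(3)\subset\mathfrak{so}(6)\cong\Lambda^2$ be the stabiliser algebra of $\phi$, with orthogonal complement $\mathfrak{su}(3)^\perp$. The intrinsic torsion $\Gamma$ is the unique section of $T^*M\otimes\mathfrak{su}(3)^\perp$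 such that $\nabla^n_XY:=\nabla_XY-\Gamma(X)(Y)$ is an $\mathrm{SU}(3)$-connection, i.e. its spinor lift $\nabla^n_X\phi^*=\nabla_X\phi^*-\frac12\Gamma(X)\phi^*$ satisfies $\nabla^n\phi=0$. It is viewed as a tensor $\Gamma(X,Y,Z)=g(\Gamma(X)(Y),Z)$. *)

(* Defs.v *)
From HB Require Import structures.
From mathcomp Require Import all_boot all_order all_algebra.
From mathcomp Require Import all_classical all_reals all_analysis.

Set Implicit Arguments.
Unset Strict Implicit.
Unset Printing Implicit Defensive.

Import Order.TTheory GRing.Theory Num.Theory.
Import numFieldNormedType.Exports.

Local Open Scope classical_set_scope.
Local Open Scope ring_scope.

(* Conventions.  Tangent vectors are row vectors, so an endomorphism with
   matrix S sends X to X *m S.  Spinors are column vectors in R^8.  A chart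
   comes with a spin frame, that is, a local section of the spin frame bundle:
   tensors and spinors on the manifold are families of local components with
   respect to these frames, related by the transition laws on overlaps.  As the
   frames are orthonormal, g is the standard inner product in components. *)

Section Smooth.
Variable R : realType.

(* For U open, Ck n U f says that f is of class C^n on U. *)
Fixpoint Ck (n : nat) (U : set 'rV[R]_6) (f : 'rV[R]_6 -> R) : Prop :=
  match n with
  | 0 => forall x, U x -> {for x, continuous f}
  | m.+1 => (forall x, U x -> differentiable f x) /\
            (forall v : 'rV[R]_6, Ck m U ('D_v f))
  end.

Definition smooth (U : set 'rV[R]_6) (f : 'rV[R]_6 -> R) : Prop :=
  forall n, Ck n U f.

Definition smooth_mx m n (U : set 'rV[R]_6) (F : 'rV[R]_6 -> 'M[R]_(m, n)) :=
  forall a b, smooth U (fun x => F x a b).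

End Smooth.

Section Manifold.
Variable R : realType.

(* par i is the inverse of the chart coord i; the values of coord i off dom i,
   and of par i off the image of dom i, are irrelevant. *)
Record oriented_manifold (M : topologicalType) := OrientedManifold {
  chart : Type;
  dom : chart -> set M;
  coord : chart -> M -> 'rV[R]_6;
  par : chart -> 'rV[R]_6 -> M;
  manifold_hausdorff : hausdorff_space M;
  manifold_second_countable : @second_countable M;
  dom_open : forall i, open (dom i);
  dom_cover : forall p, exists i, dom i p;
  coord_open : forall i, open (coord i @` dom i);
  coordK : forall i p, dom i p -> par i (coord i p) = p;
  coord_continuous : forall i, {within dom i, continuous (coord i)};
  par_continuous : forall i, {within coord i @` dom i, continuous (par i)};
  transition_smooth : forall i j,
    smooth_mx (coord i @` (dom i `&` dom j)) (coord j \o par i);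
  transition_oriented : forall i j p, dom i p -> dom j p ->
    0 < \det (jacobian (coord j \o par i) (coord i p))
}.

Variable M : topologicalType.

(* The differential at p of the change of coordinates from i to j; it acts on
   row vectors of coordinate components by right multiplication. *)
Definition Jac (A : oriented_manifold M) (i j : chart A) (p : M) : 'M[R]_6 :=
  jacobian (coord j \o par i) (coord i p).

Definition smooth_local (A : oriented_manifold M) m n (i : chart A)
    (U : set M) (F : M -> 'M[R]_(m, n)) : Prop :=
  smooth_mx (coord i @` U) (F \o par i).

Record riem_metric (A : oriented_manifold M) := RiemMetric {
  gmx : chart A -> M -> 'M[R]_6;
  gmx_sym : forall i p, dom i p -> (gmx i p)^T = gmx i p;
  gmx_pos : forall i p (u : 'rV[R]_6), dom i p -> u != 0 ->
    0 < (u *m gmx i p *m u^T) 0 0;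
  gmx_smooth : forall i, smooth_local i (dom i) (gmx i);
  gmx_transition : forall i j p, dom i p -> dom j p ->
    gmx i p = Jac i j p *m gmx j p *m (Jac i j p)^T
}.

End Manifold.

Section Clifford.
Variable R : realType.

Record clifford_module := CliffordModule {
  gam : 'I_6 -> 'M[R]_8;
  gam_skew : forall a, (gam a)^T = - gam a;
  gam_clifford : forall a b,
    gam a *m gam b + gam b *m gam a = (- 2 * (a == b)%:R)%:M
}.

Variable G : clifford_module.

Definition cl (X : 'rV[R]_6) : 'M[R]_8 := \sum_(a < 6) X 0 a *: gam G a.

Definition jvol : 'M[R]_8 := \prod_(a < 6) gam G a.

Definition dotv (X Y : 'rV[R]_6) : R := (X *m Y^T) 0 0.
Definition dots (s t : 'cV[R]_8) : R := (s^T *m t) 0 0.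

Definition skew (al : 'M[R]_6) : Prop := al^T = - al.

(* Under g(A(Y), Z) = al(Y, Z) and A(Y) = Y *m A, the skew endomorphism A and
   the 2-form al have the same matrix. *)
Definition form2_act (al : 'M[R]_6) : 'M[R]_8 :=
  \sum_(a < 6) \sum_(b < 6 | (a < b)%N) al a b *: (gam G a *m gam G b).

Definition form2_dot (al be : 'M[R]_6) : R :=
  \sum_(a < 6) \sum_(b < 6 | (a < b)%N) al a b * be a b.

Definition su3 (phi : 'cV[R]_8) (al : 'M[R]_6) : Prop :=
  skew al /\ form2_act al *m phi = 0.

Definition su3_perp (phi : 'cV[R]_8) (be : 'M[R]_6) : Prop :=
  skew be /\ forall al, su3 phi al -> form2_dot al be = 0.

(* Spin(6): products of an even number of unit vectors. *)
Definition Spin6 (h : 'M[R]_8) : Prop :=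
  exists s : seq 'rV[R]_6,
    [/\ ~~ odd (size s), (forall v, v \in s -> dotv v v = 1) &
        h = \prod_(v <- s) cl v].

End Clifford.

Section SpinStructure.
Variables (R : realType) (G : clifford_module R) (M : topologicalType).
Variables (A : oriented_manifold R M) (g : riem_metric A).

(* Row a of frame i p holds the coordinates of the a-th frame vector e_a. *)
Definition frame_change (frame : chart A -> M -> 'M[R]_6)
    (i j : chart A) (p : M) : 'M[R]_6 :=
  frame i p *m Jac i j p *m invmx (frame j p).

(* A spin structure given by spin frames over the chart domains: the oriented
   orthonormal frames they cover, and the Spin(6)-valued transition functions
   lifting the SO(6)-valued frame changes.  A vector of components X in the
   frame i has components X *m frame_change i j p in the frame j, and a spinor
   of components s has components lift i j p *m s. *)
Record spin_structure := SpinStructure {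
  frame : chart A -> M -> 'M[R]_6;
  frame_smooth : forall i, smooth_local i (dom i) (frame i);
  frame_orthonormal : forall i p, dom i p ->
    frame i p *m gmx g i p *m (frame i p)^T = 1%:M;
  frame_oriented : forall i p, dom i p -> 0 < \det (frame i p);
  lift : chart A -> chart A -> M -> 'M[R]_8;
  lift_smooth : forall i j, smooth_local i (dom i `&` dom j) (lift i j);
  lift_Spin6 : forall i j p, dom i p -> dom j p -> Spin6 G (lift i j p);
  lift_cocycle : forall i j k p, dom i p -> dom j p -> dom k p ->
    lift j k p *m lift i j p = lift i k p;
  lift_covers : forall i j p (X : 'rV[R]_6), dom i p -> dom j p ->
    lift i j p *m cl G X = cl G (X *m frame_change frame i j p) *m lift i j p
}.

Variable s : spin_structure.

Local Notation chg := (frame_change (frame s)).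

Definition spinor_field (phi : chart A -> M -> 'cV[R]_8) : Prop :=
  (forall i, smooth_local i (dom i) (phi i)) /\
  (forall i j p, dom i p -> dom j p -> phi j p = lift s i j p *m phi i p).

Definition oneform_field (eta : chart A -> M -> 'rV[R]_6) : Prop :=
  (forall i, smooth_local i (dom i) (eta i)) /\
  (forall i j p (X : 'rV[R]_6), dom i p -> dom j p ->
     dotv (eta i p) X = dotv (eta j p) (X *m chg i j p)).

Definition endo_field (S : chart A -> M -> 'M[R]_6) : Prop :=
  (forall i, smooth_local i (dom i) (S i)) /\
  (forall i j p (X : 'rV[R]_6), dom i p -> dom j p ->
     X *m S i p *m chg i j p = X *m chg i j p *m S j p).

(* For T with components T a b c = T(e_a, e_b, e_c), T(X) is the bilinear form
   (or the endomorphism) T(X, _, _). *)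
Definition contract (T : 'I_6 -> 'M[R]_6) (X : 'rV[R]_6) : 'M[R]_6 :=
  \sum_(a < 6) X 0 a *: T a.

Definition eval3 (T : 'I_6 -> 'M[R]_6) (X Y Z : 'rV[R]_6) : R :=
  dotv (Y *m contract T X) Z.

Definition tensor3_field (T : chart A -> M -> 'I_6 -> 'M[R]_6) : Prop :=
  (forall i a, smooth_local i (dom i) (fun p => T i p a)) /\
  (forall i j p (X Y Z : 'rV[R]_6), dom i p -> dom j p ->
     eval3 (T i p) X Y Z =
     eval3 (T j p) (X *m chg i j p) (Y *m chg i j p) (Z *m chg i j p)).

(* Derivative at p of local components F in the direction with coordinate
   components u. *)
Definition dir m n (i : chart A) (u : 'rV[R]_6)
    (F : M -> 'M[R]_(m.+1, n.+1)) (p : M) : 'M[R]_(m.+1, n.+1) :=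
  'D_u (F \o par i) (coord i p).

Definition dgmx (i : chart A) (k : 'I_6) (p : M) : 'M[R]_6 :=
  dir i (delta_mx 0 k) (gmx g i) p.

(* The coordinates of nabla_{d_k} d_l. *)
Definition christoffel (i : chart A) (p : M) (k l : 'I_6) : 'rV[R]_6 :=
  (\row_(m < 6) (2^-1 * (dgmx i k p l m + dgmx i l p k m - dgmx i m p k l)))
    *m invmx (gmx g i p).

(* The Levi-Civita connection, in coordinates. *)
Definition nabla (i : chart A) (u : 'rV[R]_6) (Y : M -> 'rV[R]_6) (p : M)
    : 'rV[R]_6 :=
  dir i u Y p +
  \sum_(k < 6) \sum_(l < 6) (u 0 k * Y p 0 l) *: christoffel i p k l.

(* The Levi-Civita connection in the frame: the (a, b) entry is
   g(nabla_X e_a, e_b), for X with components X in the frame. *)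
Definition lc_form (i : chart A) (X : 'rV[R]_6) (p : M) : 'M[R]_6 :=
  \matrix_(a < 6, b < 6)
    (nabla i (X *m frame s i p) (fun q => row a (frame s i q)) p
       *m gmx g i p *m (row b (frame s i p))^T) 0 0.

(* The spinor lift of a metric connection with form theta in the frame:
   X(phi) + 1/2 sum_(a < b) g(nabla_X e_a, e_b) e_a e_b phi. *)
Definition spin_nabla (i : chart A)
    (theta : chart A -> 'rV[R]_6 -> M -> 'M[R]_6) (X : 'rV[R]_6)
    (phi : chart A -> M -> 'cV[R]_8) (p : M) : 'cV[R]_8 :=
  dir i (X *m frame s i p) (phi i) p
  + 2^-1 *: (form2_act G (theta i X p) *m phi i p).

(* The form of the connection nabla_X Y - Gamma(X)(Y). *)
Definition normal_form (Gamma : chart A -> M -> 'I_6 -> 'M[R]_6)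
    (i : chart A) (X : 'rV[R]_6) (p : M) : 'M[R]_6 :=
  lc_form i X p - contract (Gamma i p) X.

Variable phi : chart A -> M -> 'cV[R]_8.

Definition unit_spinor : Prop :=
  spinor_field phi /\ forall i p, dom i p -> dots (phi i p) (phi i p) = 1.

Definition is_complex_structure (J : chart A -> M -> 'M[R]_6) : Prop :=
  endo_field J /\
  forall i p (X : 'rV[R]_6), dom i p ->
    cl G (X *m J i p) *m phi i p = jvol G *m (cl G X *m phi i p).

Definition omega (J : chart A -> M -> 'M[R]_6) (i : chart A) (p : M)
    (X Y : 'rV[R]_6) : R := dotv X (Y *m J i p).

Definition psi (i : chart A) (p : M) (X Y Z : 'rV[R]_6) : R :=
  - dots (cl G X *m (cl G Y *m (cl G Z *m phi i p))) (phi i p).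

Definition intrinsic_endo_form (S : chart A -> M -> 'M[R]_6)
    (eta : chart A -> M -> 'rV[R]_6) : Prop :=
  [/\ endo_field S, oneform_field eta &
      forall i p (X : 'rV[R]_6), dom i p ->
        spin_nabla i lc_form X phi p =
        dotv (eta i p) X *: (jvol G *m phi i p)
        + cl G (X *m S i p) *m phi i p].

Definition intrinsic_torsion (Gamma : chart A -> M -> 'I_6 -> 'M[R]_6) : Prop :=
  [/\ tensor3_field Gamma,
      forall i p (X : 'rV[R]_6), dom i p ->
        su3_perp G (phi i p) (contract (Gamma i p) X) &
      forall i p (X : 'rV[R]_6), dom i p ->
        spin_nabla i (normal_form Gamma) X phi p = 0].

End SpinStructure.

(* Main.v *)
(* Write Lambda(t) for the 2-form (Y, Z) |-> (Y Z phi, t).  It is orthogonal to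
   su(3), since (al phi, t) = <al, Lambda(t)> for every 2-form al.  The spinors
   phi, j phi, e_1 phi, ..., e_6 phi form an orthonormal basis, so that
   sum_b (e_b phi)(e_b phi)^T = 1 - phi phi^T - (j phi)(j phi)^T, and summing
   once more over a yields Lambda(V phi) phi = 2 V phi and
   Lambda(j phi) phi = 3 j phi.  Hence Gamma(X) = Lambda(t) with
   t = S(X) phi + 2/3 eta(X) j phi satisfies 1/2 Gamma(X) phi = nabla_X phi.  It
   is the only element of su(3)^perp doing so, because the difference of two
   such lies in su(3) as well. *)
From HB Require Import structures.
Require Import Defs.
From mathcomp Require Import all_boot all_order all_algebra.
From mathcomp Require Import all_classical all_reals all_analysis.
Set Implicit Arguments.
Unset Strict Implicit.
Unset Printing Implicit Defensive.
Import Order.TTheory GRing.Theory Num.Theory.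
Import numFieldNormedType.Exports.
Local Open Scope classical_set_scope.
Local Open Scope ring_scope.

(** * Calculus of smooth functions and matrix-valued functions on an open set *)

Section Smooth.
Variable R : realType.
Implicit Types (U : set 'rV[R]_6) (f g : 'rV[R]_6 -> R).

(** Differentiability depends only on the germ at [x]: the first-order expansion of [f] is also one
    of [g], and uniqueness of the differential identifies ['d g x] with ['d f x]. *)
Lemma near_eq_differentiable (V W : normedModType R) (f g : V -> W) (x : V) :
  (\near x, f x = g x) -> differentiable f x -> differentiable g x.
Proof.
move=> fg /diff_locallyP[cf ef].
have eg : g \o shift x = cst (g x) + 'd f x +o_ 0 id.
  apply/eqaddoP => e e0; move/eqaddoP: ef => /(_ e e0) ef.
  (* The little-o estimate is in the increment [h], so the neighbourhood of [x] is translated to one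
     of 0. *)
  have fg0 : \forall h \near (0 : V), f (h + x) = g (h + x).
    move: fg; rewrite (near_shift 0 x); apply: filterS => h /=.
    by rewrite subr0.
  apply: filterS2 ef fg0 => h /= + fgh.
  by rewrite /= !fctE /= fgh (nbhs_singleton fg).
by apply/diff_locallyP; rewrite (diff_unique cf eg).
Qed.

(** Since [U] is open, equality on [U] is equality near each of its points; the directional
    derivatives then agree on [U] too, and the induction goes through for varying [f] and [g]. *)
Lemma Ck_eq_on n U f g : open U -> (forall x, U x -> f x = g x) ->
  Ck n U f -> Ck n U g.
Proof.
move=> oU; elim: n f g => [|n IH] f g fg.
  have near_fg x : U x -> \near x, f x = g x.
    by move=> Ux; apply: filterS (open_nbhs_nbhs (conj oU Ux)).
  move=> cf x Ux; rewrite /prop_for /continuous_at -(fg x Ux).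
  have /near_eq_cvg fgx : {near x, f =1 g} := near_fg x Ux.
  exact: cvg_trans fgx (cf x Ux).
have near_fg x : U x -> \near x, f x = g x.
  by move=> Ux; apply: filterS (open_nbhs_nbhs (conj oU Ux)).
case=> df cf; split=> [x Ux|v].
  exact: near_eq_differentiable (near_fg x Ux) (df x Ux).
by apply: IH (cf v) => x Ux; exact: near_eq_derive (near_fg x Ux).
Qed.

Lemma smooth_eq_on U f g : open U -> (forall x, U x -> f x = g x) ->
  smooth U f -> smooth U g.
Proof. by move=> oU fg sf n; exact: Ck_eq_on oU fg (sf n). Qed.

Lemma smooth_differentiable U f x : smooth U f -> U x -> differentiable f x.
Proof. by move=> /(_ 1)[+ _]; exact. Qed.

Lemma smooth_derive U f v : smooth U f -> smooth U ('D_v f).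
Proof. by move=> sf n; case: (sf n.+1) => _; exact. Qed.

Lemma smooth_cst U (c : R) : smooth U (cst c).
Proof.
move=> n; elim: n c => [|n IH] c; first by move=> x _; exact: cst_continuous.
split=> [x _|v]; first exact: differentiable_cst.
suff -> : 'D_v (cst c : 'rV[R]_6 -> R) = cst 0 by exact: IH.
by apply/funext => x; rewrite derive_cst.
Qed.

Lemma CkD n U f g : open U -> Ck n U f -> Ck n U g ->
  Ck n U (fun x => f x + g x).
Proof.
move=> oU; elim: n f g => [|n IH] f g.
  by move=> cf cg x Ux; apply: continuousD; [exact: cf|exact: cg].
case=> df cf [dg cg]; split=> [x Ux|v].
  by apply: differentiableD; [exact: df|exact: dg].
apply: Ck_eq_on oU _ (IH _ _ (cf v) (cg v)) => x Ux.
rewrite (_ : (fun x => _) = f + g)//.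
by rewrite deriveD//; apply: diff_derivable; [exact: df|exact: dg].
Qed.

Lemma smoothD U f g : open U -> smooth U f -> smooth U g ->
  smooth U (fun x => f x + g x).
Proof. by move=> oU sf sg n; exact: CkD. Qed.

(** The product rule leaves one factor undifferentiated, so an induction assuming only [Ck n] of
    both factors would also have to lower orders. Smooth factors provide every order at once. *)
Lemma smoothM U f g : open U -> smooth U f -> smooth U g ->
  smooth U (fun x => f x * g x).
Proof.
move=> oU sf sg n; elim: n f g sf sg => [|n IH] f g sf sg.
  by move=> x Ux; apply: continuousM; [exact: sf 0 x Ux|exact: sg 0 x Ux].
have df x : U x -> differentiable f x by exact: smooth_differentiable.
have dg x : U x -> differentiable g x by exact: smooth_differentiable.
split=> [x Ux|v]; first by apply: differentiableM; [exact: df|exact: dg].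
apply: (@Ck_eq_on _ _ (fun x => f x * 'D_v g x + g x * 'D_v f x)) => //.
  move=> x Ux; rewrite (_ : (fun x => f x * g x) = f * g)//.
  by rewrite deriveM//; apply: diff_derivable; [exact: df|exact: dg].
by apply: CkD => //; apply: IH => //; exact: smooth_derive.
Qed.

Lemma smooth_sum U (I : Type) (r : seq I) (P : pred I)
    (F : I -> 'rV[R]_6 -> R) : open U -> (forall i, smooth U (F i)) ->
  smooth U (fun x => \sum_(i <- r | P i) F i x).
Proof.
move=> oU sF; elim: r => [|i r IH].
  under [X in smooth _ X]eq_fun do rewrite big_nil.
  exact: smooth_cst.
under [X in smooth _ X]eq_fun do rewrite big_cons.
by case: (P i) => //; exact: smoothD.
Qed.

Section Matrix.
Variable U : set 'rV[R]_6.
Hypothesis oU : open U.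

Lemma smooth_mx_eq_on m n (F H : 'rV[R]_6 -> 'M[R]_(m, n)) :
  (forall x, U x -> F x = H x) -> smooth_mx U F -> smooth_mx U H.
Proof.
by move=> FH sF a b; apply: smooth_eq_on oU _ (sF a b) => x Ux; rewrite FH.
Qed.

Lemma smooth_mx_cst m n (C : 'M[R]_(m, n)) : smooth_mx U (fun=> C).
Proof. by move=> a b; exact: smooth_cst. Qed.

Lemma smooth_mxD m n (F H : 'rV[R]_6 -> 'M[R]_(m, n)) :
  smooth_mx U F -> smooth_mx U H -> smooth_mx U (fun x => F x + H x).
Proof.
move=> sF sH a b; rewrite (_ : (fun _ => _) = (fun x => F x a b + H x a b)).
  exact: smoothD.
by rewrite funeqE => x; rewrite mxE.
Qed.

Lemma smooth_mxM m n p (F : 'rV[R]_6 -> 'M[R]_(m, n))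
    (H : 'rV[R]_6 -> 'M[R]_(n, p)) :
  smooth_mx U F -> smooth_mx U H -> smooth_mx U (fun x => F x *m H x).
Proof.
move=> sF sH a b.
rewrite (_ : (fun _ => _) = (fun x => \sum_k F x a k * H x k b)).
  by apply: smooth_sum => // k; exact: smoothM.
by rewrite funeqE => x; rewrite mxE.
Qed.

Lemma smooth_mxZ m n (c : 'rV[R]_6 -> R) (F : 'rV[R]_6 -> 'M[R]_(m, n)) :
  smooth U c -> smooth_mx U F -> smooth_mx U (fun x => c x *: F x).
Proof.
move=> sc sF a b; rewrite (_ : (fun _ => _) = (fun x => c x * F x a b)).
  exact: smoothM.
by rewrite funeqE => x; rewrite mxE.
Qed.

Lemma smooth_mx_sum m n (I : Type) (r : seq I) (P : pred I)
    (F : I -> 'rV[R]_6 -> 'M[R]_(m, n)) : (forall i, smooth_mx U (F i)) ->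
  smooth_mx U (fun x => \sum_(i <- r | P i) F i x).
Proof.
move=> sF a b.
rewrite (_ : (fun _ => _) = (fun x => \sum_(i <- r | P i) F i x a b)).
  by apply: smooth_sum => // i; exact: sF.
by rewrite funeqE => x; rewrite summxE.
Qed.

Lemma smooth_mx_tr m n (F : 'rV[R]_6 -> 'M[R]_(m, n)) :
  smooth_mx U F -> smooth_mx U (fun x => (F x)^T).
Proof.
move=> sF a b; rewrite (_ : (fun _ => _) = (fun x => F x b a)) ?funeqE//.
by move=> x; rewrite mxE.
Qed.

End Matrix.
End Smooth.

(** Passes from the sums over [a < b] that define the action and product of 2-forms to full double
    sums, which can be summed one index at a time. *)
Lemma sum_sym (V : zmodType) n (F : 'I_n -> 'I_n -> V) :
  (forall a, F a a = 0) -> (forall a b, F a b = F b a) ->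
  \sum_(a < n) \sum_(b < n) F a b
  = (\sum_(a < n) \sum_(b < n | (a < b)%N) F a b) *+ 2.
Proof.
move=> F0 Fs; rewrite mulr2n.
have ltS : \sum_(a < n) \sum_(b < n | (b < a)%N) F a b
          = \sum_(a < n) \sum_(b < n | (a < b)%N) F a b.
  rewrite (exchange_big_dep xpredT)//=.
  by apply: eq_bigr => a _; apply: eq_bigr => b _; exact: Fs.
rewrite -{1}ltS -big_split/=.
apply: eq_bigr => a _; rewrite (bigID (fun b : 'I_n => (b < a)%N))/=.
congr (_ + _); under eq_bigl do rewrite -leqNgt.
rewrite (bigD1 a)//= F0 add0r; apply: eq_bigl => b.
by rewrite ltn_neqAle andbC eq_sym.
Qed.

(** * Clifford multiplication, the volume element and the action of 2-forms *)

Section Clifford.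
Variables (R : realType) (G : clifford_module R).
Local Notation gam := (gam G).
Local Notation cl := (cl G).
Local Notation j := (jvol G).

Lemma dotvE (X Y : 'rV[R]_6) : dotv X Y = \sum_(a < 6) X 0 a * Y 0 a.
Proof. by rewrite /dotv mxE; apply: eq_bigr => a _; rewrite mxE. Qed.

Lemma dotv_delta a b :
  dotv (delta_mx 0 a : 'rV[R]_6) (delta_mx 0 b) = (a == b)%:R.
Proof.
by rewrite /dotv trmx_delta mul_delta_mx_cond; case: eqP; rewrite mxE.
Qed.

Lemma dots_scalar (s t : 'cV[R]_8) : s^T *m t = (dots s t)%:M.
Proof. by rewrite [LHS]mx11_scalar. Qed.

Lemma dotsC (s t : 'cV[R]_8) : dots s t = dots t s.
Proof. by rewrite /dots !mxE; apply: eq_bigr => a _; rewrite !mxE mulrC. Qed.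

Lemma dotsDr (s t u : 'cV[R]_8) : dots s (t + u) = dots s t + dots s u.
Proof. by rewrite /dots mulmxDr mxE. Qed.

Lemma dots_linear (s : 'cV[R]_8) : scalar (dots s).
Proof. by move=> c t u; rewrite /dots mulmxDr -scalemxAr !mxE. Qed.

HB.instance Definition _ (s : 'cV[R]_8) :=
  GRing.isLinear.Build R _ _ _ (dots s) (dots_linear s).

Lemma dotsZr c (s t : 'cV[R]_8) : dots s (c *: t) = c * dots s t.
Proof. by rewrite /dots -scalemxAr mxE. Qed.

Lemma dotsNr (s t : 'cV[R]_8) : dots s (- t) = - dots s t.
Proof. by rewrite /dots mulmxN mxE. Qed.

Lemma dotsNl (s t : 'cV[R]_8) : dots (- s) t = - dots s t.
Proof. by rewrite dotsC dotsNr dotsC. Qed.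

Lemma dots_adj (B : 'M[R]_8) (s t : 'cV[R]_8) :
  dots (B *m s) t = dots s (B^T *m t).
Proof. by rewrite /dots trmx_mul mulmxA. Qed.

Lemma dots_skew (B : 'M[R]_8) (s : 'cV[R]_8) : B^T = - B -> dots (B *m s) s = 0.
Proof.
move=> BT; have := dots_adj B s s; rewrite BT mulNmx dotsNr dotsC => /eqP.
by rewrite -subr_eq0 opprK -mulr2n mulrn_eq0 => /eqP.
Qed.

Lemma cl_delta a : cl (delta_mx 0 a) = gam a.
Proof.
rewrite /Defs.cl (bigD1 a)//= mxE !eqxx scale1r big1 ?addr0// => b ba.
by rewrite mxE (negbTE ba) andbF scale0r.
Qed.

Lemma mul_cl X (s : 'cV[R]_8) :
  cl X *m s = \sum_(a < 6) X 0 a *: (gam a *m s).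
Proof.
rewrite /Defs.cl mulmx_suml; apply: eq_bigr => a _.
by rewrite -scalemxAl.
Qed.

Lemma cl_skew X : (cl X)^T = - cl X.
Proof.
rewrite /Defs.cl linear_sum -sumrN; apply: eq_bigr => a _ /=.
by rewrite linearZ/= gam_skew scalerN.
Qed.

Lemma cl_anti X Y : cl X *m cl Y + cl Y *m cl X = (- 2 * dotv X Y)%:M.
Proof.
rewrite /Defs.cl mulmx_suml mulmx_sumr -big_split/=.
under eq_bigr => a _.
  rewrite mulmx_sumr mulmx_suml -big_split/=.
  under eq_bigr => b _ do
    rewrite -!scalemxAl -!scalemxAr !scalerA (mulrC (Y 0 b)) -scalerDr
            gam_clifford.
  rewrite (bigD1 a)//= eqxx big1; last first.
    by move=> b /negbTE ba; rewrite eq_sym ba mulr0 raddf0 scaler0.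
  rewrite addr0 mulr1 scale_scalar_mx.
  over.
rewrite -raddf_sum/= dotvE mulr_sumr; congr (_%:M).
by apply: eq_bigr => a _; rewrite mulrC.
Qed.

Lemma gam_sq a : gam a *m gam a = (-1)%:M.
Proof.
apply: (scalerI (a := 2)); first by rewrite pnatr_eq0.
by rewrite scaler_nat mulr2n gam_clifford eqxx scale_scalar_mx mulrN mulNr.
Qed.

Lemma gam_orth a : gam a *m (gam a)^T = 1%:M.
Proof. by rewrite gam_skew mulmxN gam_sq raddfN opprK. Qed.

Lemma gamC a b : a != b -> gam a *m gam b = - (gam b *m gam a).
Proof.
move=> ab; apply/eqP; rewrite -addr_eq0 gam_clifford (negbTE ab) mulr0.
by rewrite raddf0.
Qed.

Lemma gam_prod_cons a (r : seq 'I_6) :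
  \prod_(b <- a :: r) gam b = gam a *m \prod_(b <- r) gam b.
Proof. exact: big_cons. Qed.

(** Moving [gam a] to the right costs a sign at each factor other than [gam a] itself. *)
Lemma gam_prod a (r : seq 'I_6) :
  gam a *m \prod_(b <- r) gam b
  = (-1) ^+ count (predC1 a) r *: (\prod_(b <- r) gam b *m gam a).
Proof.
elim: r => [|b r IH]; first by rewrite big_nil mulmx1 mul1mx scale1r.
rewrite gam_prod_cons /= mulmxA; case: (eqVneq b a) => [->|ba] /=.
  by rewrite add0n -[in LHS]mulmxA [in LHS]IH -scalemxAr !mulmxA.
rewrite gamC 1?eq_sym// mulNmx -[in LHS]mulmxA [in LHS]IH -scalemxAr.
by rewrite mulmxA add1n exprS mulN1r scaleNr.
Qed.

(** Transposing [n] distinct factors gives [n] signs from skewness and [n(n-1)/2] from restoring the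
    order, in total [n(n+1)/2]. *)
Lemma gam_prod_tr (r : seq 'I_6) : uniq r ->
  (\prod_(b <- r) gam b)^T
  = (-1) ^+ 'C((size r).+1, 2) *: \prod_(b <- r) gam b.
Proof.
elim: r => [|a r IH]; first by rewrite big_nil trmx1 scale1r.
rewrite cons_uniq => /andP[ar /IH {}IH].
rewrite gam_prod_cons trmx_mul IH gam_skew.
have cr : count (predC1 a) r = size r.
  apply/eqP; rewrite -all_count; apply/allP => b br /=.
  by apply: contraNneq ar => <-.
rewrite gam_prod cr scalerA -exprD mulmxN -scalemxAl -scaleN1r scalerA -exprS.
have -> : 'C((size (a :: r)).+1, 2) = ('C((size r).+1, 2) + (size r).+1)%N.
  by rewrite binS bin1.
congr (_ *: _); move: (size r) 'C((size r).+1, 2) => n c.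
rewrite -signr_odd -[RHS]signr_odd !oddD !oddS.
by case: (odd c); case: (odd n).
Qed.

Lemma gam_prod_orth (r : seq 'I_6) :
  (\prod_(b <- r) gam b)^T *m \prod_(b <- r) gam b = 1%:M.
Proof.
elim: r => [|a r IH]; first by rewrite big_nil trmx1 mul1mx.
rewrite gam_prod_cons trmx_mul gam_skew mulmxN mulNmx -mulmxA.
by rewrite [gam a *m (_ *m _)]mulmxA gam_sq mul_scalar_mx scaleN1r mulmxN opprK.
Qed.

Lemma jvol_gam a : j *m gam a = - (gam a *m j).
Proof.
(* Five of the six factors of the volume element differ from [gam a], and five is odd. *)
rewrite gam_prod; have -> : count (predC1 a) (index_enum 'I_6) = 5.
  have := cardC1 a; rewrite card_ord cardE /enum_mem size_filter. exact.
by rewrite exprS -signr_odd /= expr0 mulr1 scaleN1r opprK.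
Qed.

Lemma jvol_cl X : j *m cl X = - (cl X *m j).
Proof.
rewrite /Defs.cl mulmx_sumr mulmx_suml -sumrN; apply: eq_bigr => a _.
by rewrite -scalemxAr jvol_gam scalerN scalemxAl.
Qed.

Lemma jvol_orth : j^T *m j = 1%:M.
Proof. exact: gam_prod_orth. Qed.

Lemma jvol_tr : j^T = - j.
Proof.
have /gam_prod_tr : uniq (index_enum 'I_6) by exact: index_enum_uniq.
have -> : size (index_enum 'I_6) = 6.
  by have := card_ord 6; rewrite cardE enumT.
(* The exponent is ['C(7, 2)], that is 21, which is odd. *)
by rewrite -signr_odd expr1 scaleN1r.
Qed.

(** By skewness the left side is [-(s, X Y s)]; being symmetric in [X] and [Y], it only sees the
    anticommutator. *)
Lemma dots_cl (X Y : 'rV[R]_6) (s : 'cV[R]_8) :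
  dots (cl X *m s) (cl Y *m s) = dotv X Y * dots s s.
Proof.
have E U V : dots (cl U *m s) (cl V *m s) = - dots s (cl U *m cl V *m s).
  by rewrite dots_adj cl_skew mulNmx dotsNr mulmxA.
have : dots (cl X *m s) (cl Y *m s) *+ 2 = (dotv X Y * dots s s) *+ 2.
  rewrite mulr2n {2}dotsC !E -opprD -dotsDr -mulmxDl cl_anti.
  by rewrite mul_scalar_mx dotsZr !mulNr opprK -[RHS]mulr_natl mulrA.
by move/eqP; rewrite eqrMn2r /= => /eqP.
Qed.

Lemma dots_cl_self (X : 'rV[R]_6) (s : 'cV[R]_8) : dots (cl X *m s) s = 0.
Proof. exact: dots_skew (cl_skew X). Qed.

Lemma dots_jvol_self (s : 'cV[R]_8) : dots (j *m s) s = 0.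
Proof. exact: dots_skew jvol_tr. Qed.

Lemma dots_jvol (s t : 'cV[R]_8) : dots (j *m s) (j *m t) = dots s t.
Proof. by rewrite dots_adj mulmxA jvol_orth mul1mx. Qed.

(** [cl X] and [j] are skew and anticommute, so their product is skew as well. *)
Lemma dots_cl_jvol (X : 'rV[R]_6) (s : 'cV[R]_8) :
  dots (cl X *m s) (j *m s) = 0.
Proof.
rewrite dots_adj cl_skew mulNmx dotsNr mulmxA dotsC dots_skew ?oppr0//.
by rewrite trmx_mul jvol_tr cl_skew mulmxN mulNmx opprK jvol_cl.
Qed.

Lemma form2_act_linear : linear (form2_act G).
Proof.
move=> c al be; rewrite /form2_act scaler_sumr -big_split/=.
apply: eq_bigr => a _; rewrite scaler_sumr -big_split/=.
by apply: eq_bigr => b _; rewrite !mxE scalerDl scalerA.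
Qed.

HB.instance Definition _ :=
  GRing.isLinear.Build R _ _ _ (form2_act G) form2_act_linear.

Lemma skewE (al : 'M[R]_6) a b : Defs.skew al -> al a b = - al b a.
Proof. by move/matrixP/(_ b a); rewrite !mxE. Qed.

Lemma skew_diag (al : 'M[R]_6) a : Defs.skew al -> al a a = 0.
Proof.
move/(skewE a a)/eqP; rewrite -subr_eq0 opprK -mulr2n mulrn_eq0.
by move/eqP.
Qed.

Lemma form2_dotBr (al be ga : 'M[R]_6) :
  form2_dot al (be - ga) = form2_dot al be - form2_dot al ga.
Proof.
rewrite /form2_dot -sumrB; apply: eq_bigr => a _; rewrite -sumrB.
by apply: eq_bigr => b _; rewrite !mxE mulrBr.
Qed.

(** For a skew matrix, twice this product with itself is the sum of the squares of all entries. *)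
Lemma form2_dot_skew_eq0 (al : 'M[R]_6) :
  Defs.skew al -> form2_dot al al = 0 -> al = 0.
Proof.
move=> sk al0.
have : \sum_(a < 6) \sum_(b < 6) al a b * al a b = 0.
  rewrite sum_sym => [|a|a b]; first by rewrite -/(form2_dot al al) al0 mul0rn.
    by rewrite skew_diag// mulr0.
  by rewrite (skewE a b sk) mulrNN.
move/psumr_eq0P => al1; apply/matrixP => a b; rewrite mxE.
have sum_ge0 c : 0 <= \sum_(b < 6) al c b * al c b.
  by apply: sumr_ge0 => d _; exact: sqr_ge0.
have /psumr_eq0P al2 := al1 (fun c _ => sum_ge0 c) a isT.
have /eqP := al2 (fun d _ => sqr_ge0 (al a d)) b isT.
by rewrite mulf_eq0 orbb => /eqP.
Qed.

(** * The 2-form attached to a spinor, and its action on the unit spinor *)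

Section Spinor.
Variable phi : 'cV[R]_8.
Hypothesis phi1 : dots phi phi = 1.

(** This is [Lambda(s)]. Its diagonal entries are [-(phi, s)], so it is a genuine 2-form only for
    [s] orthogonal to [phi]. *)
Definition spinor_form (s : 'cV[R]_8) : 'M[R]_6 :=
  \matrix_(a, b) dots (gam a *m (gam b *m phi)) s.

Lemma spinor_formE (s : 'cV[R]_8) (Y Z : 'rV[R]_6) :
  dotv (Y *m spinor_form s) Z = dots (cl Y *m (cl Z *m phi)) s.
Proof.
rewrite dotvE dotsC !mul_cl linear_sum/=.
under eq_bigr => b _ do rewrite mxE mulr_suml.
rewrite exchange_big/=; apply: eq_bigr => a _.
rewrite mulmx_sumr !linearZ linear_sum/= mulr_sumr; apply: eq_bigr => b _.
by rewrite mxE -scalemxAr dotsZr dotsC -mulrA (mulrC _ (Z 0 b)).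
Qed.

(** Makes [spinor_form] adjoint to [al |-> al phi]; its values are therefore orthogonal to the
    kernel of that map, whose skew elements form [su3]. *)
Lemma form2_act_dots (al : 'M[R]_6) (s : 'cV[R]_8) :
  dots (form2_act G al *m phi) s = form2_dot al (spinor_form s).
Proof.
rewrite dotsC /form2_act mulmx_suml linear_sum; apply: eq_bigr => a _ /=.
rewrite mulmx_suml linear_sum; apply: eq_bigr => b _ /=.
by rewrite -scalemxAl dotsZr mxE dotsC mulmxA.
Qed.

Lemma spinor_form_skew (s : 'cV[R]_8) :
  dots phi s = 0 -> Defs.skew (spinor_form s).
Proof.
move=> s0; apply/matrixP => a b; rewrite !mxE !mulmxA.
case: (eqVneq b a) => [->|ba]; last by rewrite gamC// mulNmx dotsNl.
by rewrite gam_sq mul_scalar_mx scaleN1r dotsNl s0 !oppr0.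
Qed.

Lemma spinor_form_su3_perp (s : 'cV[R]_8) :
  dots phi s = 0 -> su3_perp G phi (spinor_form s).
Proof.
move=> s0; split; first exact: spinor_form_skew.
by move=> al [_ al0]; rewrite -form2_act_dots al0 /dots trmx0 mul0mx mxE.
Qed.

(** The completeness relation of the orthonormal basis [phi], [j phi], [e_1 phi], ..., [e_6 phi],
    solved for the last six terms. *)
Lemma sum_cl_outer :
  \sum_(a < 6) (gam a *m phi) *m (gam a *m phi)^T
  = 1%:M - phi *m phi^T - (j *m phi) *m (j *m phi)^T.
Proof.
pose E : 'M[R]_(8, 6) := \matrix_(k, a) (gam a *m phi) k 0.
have colE a : col a E = gam a *m phi.
  by apply/colP => k; rewrite !mxE.
have EtE : E^T *m E = 1%:M.
  apply/matrixP => a b; rewrite !mxE.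
  transitivity (dots (gam a *m phi) (gam b *m phi)).
    by rewrite /dots mxE; apply: eq_bigr => k _; rewrite !mxE.
  by rewrite -!cl_delta dots_cl dotv_delta phi1 mulr1.
have Et0 (s : 'cV[R]_8) : (forall a, dots (gam a *m phi) s = 0) -> E^T *m s = 0.
  move=> s0; apply/colP => a; rewrite mxE [RHS]mxE -[RHS](s0 a) /dots mxE.
  by apply: eq_bigr => k _; rewrite !mxE.
have Ephi : E^T *m phi = 0.
  by apply: Et0 => a; rewrite -cl_delta dots_cl_self.
have Ej : E^T *m (j *m phi) = 0.
  by apply: Et0 => a; rewrite -cl_delta dots_cl_jvol.
have tr0 m n (A : 'M[R]_(8, m)) (B : 'M[R]_(8, n)) :
    A^T *m B = 0 -> B^T *m A = 0.
  by move=> /(congr1 trmx); rewrite trmx_mul trmxK trmx0.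
pose Q : 'M[R]_(8, 1 + (1 + 6)) := row_mx phi (row_mx (j *m phi) E).
have : Q^T *m Q = 1%:M.
  rewrite !tr_row_mx mul_col_row mul_mx_row mul_col_mx mul_col_row.
  rewrite Ephi Ej EtE (tr0 _ _ _ _ Ephi) (tr0 _ _ _ _ Ej) !dots_scalar.
  rewrite dots_jvol phi1 dots_jvol_self dotsC dots_jvol_self.
  by rewrite !raddf0 col_mx0 row_mx0 -!scalar_mx_block.
(* [Q] is square, [1 + (1 + 6)] computing to 8, so its orthonormal columns give [Q Q^T = 1]. This
   replaces the identity matrix in the goal. *)
move/mulmx1C; rewrite !tr_row_mx !mul_row_col => <-.
rewrite [X in _ = X - _]addrAC subrr add0r addrAC subrr add0r.
apply/matrixP => k l; rewrite summxE [RHS]mxE; apply: eq_bigr => a _.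
by rewrite -colE !mxE big_ord1 !mxE.
Qed.

(** The full double sum is the sum over [a] of [e_a Pi e_a^T s], with [Pi] the projector onto the
    span of the [e_b phi]. Expanding [Pi] by completeness, the identity gives [6 s], and the [phi]
    and [j phi] terms reassemble into [Pi] and [j Pi j^T]. *)
Lemma spinor_form_act (s : 'cV[R]_8) : dots phi s = 0 ->
  let Pi := 1%:M - phi *m phi^T - (j *m phi) *m (j *m phi)^T in
  (form2_act G (spinor_form s) *m phi) *+ 2
  = s *+ 6 - Pi *m s - j *m (Pi *m (j^T *m s)).
Proof.
move=> s0 Pi; have skF := spinor_form_skew s0.
have -> : (form2_act G (spinor_form s) *m phi) *+ 2
    = \sum_(a < 6) gam a *m
        ((\sum_(b < 6) (gam b *m phi) *m (gam b *m phi)^T) *m ((gam a)^T *m s)).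
  rewrite mulr2n -mulmxDl -mulr2n /form2_act -sum_sym => [|a|a b].
  - rewrite mulmx_suml; apply: eq_bigr => a _.
    rewrite !mulmx_suml mulmx_sumr; apply: eq_bigr => b _.
    rewrite mxE -scalemxAl -!mulmxA [_^T *m (_^T *m _)]mulmxA -trmx_mul.
    by rewrite dots_scalar mul_mx_scalar -!scalemxAr.
  - by rewrite skew_diag// scale0r.
  - case: (eqVneq a b) => [->//|ab]; rewrite (skewE a b skF).
    by rewrite gamC// scalerN scaleNr opprK.
under eq_bigr => a _.
  rewrite sum_cl_outer !mulmxBl !mulmxBr mul1mx.
  rewrite [gam a *m ((gam a)^T *m s)]mulmxA gam_orth mul1mx.
  over.
rewrite !sumrB sumr_const card_ord; congr (_ - _ - _).
  rewrite /Pi -sum_cl_outer mulmx_suml; apply: eq_bigr => a _.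
  by rewrite trmx_mul gam_skew !mulmxA.
(* As [e_a j phi = - j e_a phi], the outer square of [e_a j phi] is that of [e_a phi] conjugated by
   [j]; the two signs cancel. *)
rewrite /Pi -sum_cl_outer mulmx_suml mulmx_sumr; apply: eq_bigr => a _.
rewrite !trmx_mul !gam_skew jvol_tr !(mulNmx, mulmxN) !mulmxA.
by rewrite -(mulmxA _ j (gam a)) !jvol_gam !(mulNmx, mulmxN) !mulmxA.
Qed.

Let Pi_mul (s : 'cV[R]_8) :
  (1%:M - phi *m phi^T - (j *m phi) *m (j *m phi)^T) *m s
  = s - dots phi s *: phi - dots (j *m phi) s *: (j *m phi).
Proof.
rewrite !mulmxBl mul1mx -!mulmxA !dots_scalar.
by rewrite !mul_mx_scalar -!scalemxAr.
Qed.

(** Both [V phi] and [j^T V phi] are orthogonal to [phi] and [j phi], so [Pi] fixes them: the factor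
    is [(6 - 1 - 1) / 2]. *)
Lemma spinor_form_cl_act (V : 'rV[R]_6) :
  form2_act G (spinor_form (cl V *m phi)) *m phi = 2 *: (cl V *m phi).
Proof.
have V0 : dots phi (cl V *m phi) = 0 by rewrite dotsC dots_cl_self.
have jV0 : dots (j *m phi) (cl V *m phi) = 0 by rewrite dotsC dots_cl_jvol.
apply: (scalerI (a := 2)); first by rewrite pnatr_eq0.
rewrite [LHS]scaler_nat.
rewrite spinor_form_act// !Pi_mul.
rewrite V0 jV0 jvol_tr mulNmx !dotsNr dots_jvol V0.
(* [(phi, j V phi) = -(j phi, V phi) = 0], since [j] is skew. *)
rewrite -[dots phi (j *m _)]opprK -dotsNr -mulNmx -jvol_tr -dots_adj jV0.
rewrite !oppr0 !scale0r !subr0 mulmxA (mulmx1C jvol_orth) mul1mx.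
by rewrite mulrSr addrK mulrSr addrK scalerA -natrM scaler_nat.
Qed.

(** Here [Pi] kills both [j phi] and [j^T j phi = phi], so the factor is [6 / 2]. *)
Lemma spinor_form_jvol_act :
  form2_act G (spinor_form (j *m phi)) *m phi = 3 *: (j *m phi).
Proof.
have j0 : dots phi (j *m phi) = 0 by rewrite dotsC dots_jvol_self.
apply: (scalerI (a := 2)); first by rewrite pnatr_eq0.
rewrite [LHS]scaler_nat.
rewrite spinor_form_act// !Pi_mul.
rewrite j0 dots_jvol phi1 scale0r scale1r subr0 subrr subr0.
rewrite [j^T *m _]mulmxA jvol_orth mul1mx phi1 scale1r dots_jvol_self scale0r.
rewrite !subrr.
by rewrite mulmx0 subr0 scalerA -natrM scaler_nat.
Qed.

End Spinor.
End Clifford.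

(** * Spin(6) acts orthogonally and commutes with [j]; linearity and components *)

Lemma Spin6_orth (R : realType) (G : clifford_module R) (h : 'M[R]_8) :
  Spin6 G h -> h^T *m h = 1%:M.
Proof.
case=> r [_ + ->]; elim: r => [|v r IH] r1.
  by rewrite big_nil trmx1 mul1mx.
(* A unit vector acts by a skew matrix of square -1, hence orthogonally. *)
have v1 : cl G v *m cl G v = (-1)%:M.
  have := cl_anti G v v; rewrite r1 ?mem_head// mulr1 -mulr2n => E.
  apply: (scalerI (a := 2)); first by rewrite pnatr_eq0.
  by rewrite scaler_nat E scale_scalar_mx mulrN mulr1.
have {}IH : (\prod_(u <- r) cl G u)^T *m \prod_(u <- r) cl G u = 1%:M.
  by apply: IH => u ur; apply: r1; rewrite inE ur orbT.
have -> : \prod_(u <- v :: r) cl G u = cl G v *m \prod_(u <- r) cl G u.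
  exact: big_cons.
rewrite trmx_mul cl_skew mulmxN mulNmx -mulmxA [cl G v *m (_ *m _)]mulmxA v1.
by rewrite mul_scalar_mx scaleN1r mulmxN opprK.
Qed.

Lemma Spin6_jvol (R : realType) (G : clifford_module R) (h : 'M[R]_8) :
  Spin6 G h -> jvol G *m h = h *m jvol G.
Proof.
case=> r [/negbTE r_even _ ->].
(* The sign is kept for products of any length, because the tail of an even product is odd. *)
suff -> : jvol G *m \prod_(v <- r) cl G v
    = (-1) ^+ odd (size r) *: (\prod_(v <- r) cl G v *m jvol G).
  by rewrite r_even scale1r.
elim: r {r_even} => [|v r IH]; first by rewrite big_nil mulmx1 mul1mx scale1r.
have -> : \prod_(u <- v :: r) cl G u = cl G v *m \prod_(u <- r) cl G u.
  exact: big_cons.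
rewrite mulmxA jvol_cl mulNmx -[in LHS]mulmxA IH -scalemxAr -mulmxA.
by rewrite -scaleN1r scalerA !signr_odd -exprS.
Qed.

Lemma spinor_formP (R : realType) (G : clifford_module R)
    (phi : 'cV[R]_8) c (s t : 'cV[R]_8) :
  spinor_form G phi (s + c *: t)
  = spinor_form G phi s + c *: spinor_form G phi t.
Proof. by apply/matrixP => a b; rewrite !mxE dotsDr dotsZr. Qed.

Section Bilinear.
Variable R : realType.

Lemma contract_delta (T : 'I_6 -> 'M[R]_6) a :
  Defs.contract T (delta_mx 0 a) = T a.
Proof.
rewrite [LHS](bigD1 a)//= big1 => [|k /negbTE ka].
  by rewrite mxE !eqxx scale1r addr0.
by rewrite mxE ka andbF scale0r.
Qed.

Lemma dotv_mulmx_inj (B C : 'M[R]_6) :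
  (forall Y Z, dotv (Y *m B) Z = dotv (Y *m C) Z) -> B = C.
Proof.
move=> BC; apply/matrixP => a b.
have := BC (delta_mx 0 a) (delta_mx 0 b).
by rewrite /dotv trmx_delta -!rowE -!colE !mxE.
Qed.

End Bilinear.

(** * The candidate torsion: action on [phi], explicit formula, frame changes, smoothness *)

Section Torsion.
Variables (R : realType) (G : clifford_module R) (M : topologicalType).
Variables (A : oriented_manifold R M) (g : riem_metric A).
Variable s : spin_structure G g.
Variable phi : chart A -> M -> 'cV[R]_8.
Hypothesis hphi : unit_spinor s phi.
Variables (S : chart A -> M -> 'M[R]_6) (eta : chart A -> M -> 'rV[R]_6).
Hypothesis hSeta : intrinsic_endo_form s phi S eta.

(** The spinor [t] with [Gamma(X) = Lambda(t)]. The action of [Lambda] scales [V phi] by 2 and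
    [j phi] by 3; the coefficient 2/3 turns both factors into 2. *)
Definition torsion_spinor (i : chart A) (p : M) (X : 'rV[R]_6) : 'cV[R]_8 :=
  cl G (X *m S i p) *m phi i p
  + (2 / 3 * dotv (eta i p) X) *: (jvol G *m phi i p).

Local Notation torsion i p X :=
  (spinor_form G (phi i p) (torsion_spinor i p X)).

Lemma torsion_act i p X : dom i p ->
  form2_act G (torsion i p X) *m phi i p
  = 2 *: spin_nabla s i (lc_form s) X phi p.
Proof.
move=> dip; have phi1 := hphi.2 i p dip.
have [_ _ ->//] := hSeta.
rewrite /torsion_spinor spinor_formP linearD linearZ /=.
rewrite mulmxDl -scalemxAl spinor_form_cl_act// spinor_form_jvol_act//.
rewrite scalerDr [RHS]addrC !scalerA; congr (_ + _ *: _).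
by rewrite mulrAC divfK ?pnatr_eq0.
Qed.

Lemma torsion_spinor_orth i p X : dots (phi i p) (torsion_spinor i p X) = 0.
Proof.
rewrite dotsC /torsion_spinor dotsC dotsDr dotsZr.
by rewrite !(dotsC (phi i p)) dots_cl_self dots_jvol_self mulr0 addr0.
Qed.

(** Skewness of [cl (S X)] turns the [psi] term into [(Y Z phi, S(X) phi)]. For the other term,
    [omega(Y, Z) = (Y phi, j Z phi) = -(Y Z phi, j phi)], which accounts for the minus sign in the
    formula. *)
Lemma torsionE (J : chart A -> M -> 'M[R]_6) i p (X Y Z : 'rV[R]_6) :
  is_complex_structure s phi J -> dom i p ->
  psi G phi i p (X *m S i p) Y Z
    - 2 / 3 * dotv (eta i p) X * omega J i p Y Z
  = dots (cl G Y *m (cl G Z *m phi i p)) (torsion_spinor i p X).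
Proof.
case=> _ hJ dip; have phi1 := hphi.2 i p dip.
rewrite /torsion_spinor dotsDr dotsZr; congr (_ + _).
  by rewrite /psi dots_adj cl_skew mulNmx dotsNr opprK.
rewrite -mulrN; congr (_ * _).
rewrite /omega -[dotv _ _]mulr1 -phi1 -(dots_cl G) hJ//.
(* Exchanging [Y] and [Z] lets [Z] be moved across the inner product; the correction is a multiple
   of [phi], orthogonal to [j phi]. *)
have -> : cl G Y *m (cl G Z *m phi i p)
    = (- 2 * dotv Y Z) *: phi i p - cl G Z *m (cl G Y *m phi i p).
  by rewrite -mul_scalar_mx -(cl_anti G) mulmxDl !mulmxA addrK.
rewrite [RHS]dotsC dotsDr dotsZr dots_jvol_self mulr0 add0r dotsNr.
rewrite [in RHS]dotsC.
by rewrite [in RHS]dots_adj cl_skew !mulmxA jvol_cl !mulNmx.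
Qed.

(** The lift [h] intertwines Clifford multiplication and commutes with [j], so both spinors are
    multiplied by [h], which preserves the inner product. *)
Lemma torsion_transition i k p (X Y Z : 'rV[R]_6) : dom i p -> dom k p ->
  let c := frame_change (frame s) i k p in
  dots (cl G Y *m (cl G Z *m phi i p)) (torsion_spinor i p X)
  = dots (cl G (Y *m c) *m (cl G (Z *m c) *m phi k p))
         (torsion_spinor k p (X *m c)).
Proof.
move=> dip dkp c; have [[_ hS] [_ heta] _] := hSeta.
pose h := Defs.lift s i k p.
have phik : phi k p = h *m phi i p by exact: hphi.1.2.
have hcl V : cl G (V *m c) *m h = h *m cl G V by rewrite lift_covers.
have hSpin : Spin6 G h by exact: lift_Spin6.
have tk : torsion_spinor k p (X *m c) = h *m torsion_spinor i p X.
  rewrite /torsion_spinor -hS// -heta// -/c phik.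
  rewrite [cl G _ *m (h *m _)]mulmxA hcl.
  rewrite [jvol G *m (h *m _)]mulmxA (Spin6_jvol hSpin).
  by rewrite mulmxDr -scalemxAr !mulmxA.
have -> : cl G (Y *m c) *m (cl G (Z *m c) *m phi k p)
    = h *m (cl G Y *m (cl G Z *m phi i p)).
  rewrite phik [cl G (Z *m c) *m _]mulmxA hcl.
  by rewrite -[h *m _ *m _]mulmxA [cl G _ *m (h *m _)]mulmxA hcl !mulmxA.
by rewrite tk [RHS]dots_adj [h^T *m _]mulmxA (Spin6_orth hSpin) mul1mx.
Qed.

Lemma torsion_smooth i a :
  smooth_local i (dom i) (fun p => torsion i p (delta_mx 0 a)).
Proof.
have [[sS _] [seta _] _] := hSeta; have sphi := hphi.1.1.
have oU : open (Defs.coord i @` dom i) by exact: coord_open.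
set U := (Defs.coord i @` dom i) in oU *.
have sgam_mul (C : 'M[R]_8) (F : 'rV[R]_6 -> 'cV[R]_8) :
    smooth_mx U F -> smooth_mx U (fun x => C *m F x).
  exact/(smooth_mxM oU)/smooth_mx_cst.
have st : smooth_mx U (fun x => torsion_spinor i (par i x) (delta_mx 0 a)).
  apply: (smooth_mxD oU).
    apply: (smooth_mxM oU); last exact: sphi.
    apply: (smooth_mx_sum oU) => b.
    apply: (smooth_mxZ oU); last exact: smooth_mx_cst.
    rewrite (_ : (fun _ => _) = (fun x => S i (par i x) a b)); first exact: sS.
    by rewrite funeqE => x; rewrite -rowE mxE.
  apply: (smooth_mxZ oU); last exact/sgam_mul/sphi.
  apply: (smoothM oU); first exact: smooth_cst.
  rewrite (_ : (fun _ => _) = (fun x => eta i (par i x) 0 a)).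
    exact: seta.
  by rewrite funeqE => x; rewrite /dotv trmx_delta -colE mxE.
move=> b c.
have sW : smooth_mx U (fun x => gam G b *m (gam G c *m phi i (par i x))).
  exact/sgam_mul/sgam_mul/sphi.
have := smooth_mxM oU (smooth_mx_tr sW) st.
move/(_ 0 0); congr (smooth _ _).
by rewrite funeqE => x; rewrite [RHS]mxE.
Qed.

End Torsion.

(** * The intrinsic torsion characterised by its formula *)

Theorem proposition3p3 (R : realType) (G : clifford_module R)
    (M : topologicalType) (A : oriented_manifold R M) (g : riem_metric A)
    (s : spin_structure G g)
    (phi : chart A -> M -> 'cV[R]_8) (hphi : unit_spinor s phi)
    (J : chart A -> M -> 'M[R]_6) (hJ : is_complex_structure s phi J)
    (S : chart A -> M -> 'M[R]_6) (eta : chart A -> M -> 'rV[R]_6)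
    (hSeta : intrinsic_endo_form s phi S eta)
    (Gamma : chart A -> M -> 'I_6 -> 'M[R]_6) :
  intrinsic_torsion s phi Gamma <->
  (forall (i : chart A) (p : M) (X Y Z : 'rV[R]_6), dom i p ->
     eval3 (Gamma i p) X Y Z =
     psi G phi i p (X *m S i p) Y Z
     - 2 / 3 * dotv (eta i p) X * omega J i p Y Z).
Proof.
pose T i p X : 'M[R]_6 :=
  spinor_form G (phi i p) (torsion_spinor G phi S eta i p X).
(* Subtracting [Gamma] from the connection form changes the derivative of [phi] by
   [-1/2 Gamma(X) phi], while [nabla_X phi] is [1/2 T(X) phi]. So the new connection fixes [phi]
   exactly when [T(X) - Gamma(X)] annihilates it. *)
have nablaE i p X : dom i p -> spin_nabla s i (normal_form s Gamma) X phi p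
    = 2^-1 *: (form2_act G (T i p X - Defs.contract (Gamma i p) X) *m phi i p).
  move=> dip; rewrite raddfB/= mulmxBl scalerBr (torsion_act hphi hSeta X dip).
  rewrite scalerA mulVf ?pnatr_eq0// scale1r /spin_nabla /normal_form.
  by rewrite raddfB/= mulmxBl scalerBr addrA.
have Tperp i p X : su3_perp G (phi i p) (T i p X).
  exact/spinor_form_su3_perp/torsion_spinor_orth.
split=> [[_ Gperp Gnabla] i p X Y Z dip|GE].
  rewrite (torsionE hphi S eta X Y Z hJ dip) -spinor_formE -/(T i p X) /eval3.
  suff /eqP : T i p X - Defs.contract (Gamma i p) X = 0.
    by rewrite subr_eq0 => /eqP ->.
  have [Tsk Tp] := Tperp i p X; have [Gsk Gp] := Gperp i p X dip.
  have Dsk : Defs.skew (T i p X - Defs.contract (Gamma i p) X).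
    by rewrite /Defs.skew raddfB/= Tsk Gsk opprB opprK addrC.
  have D0 : form2_act G (T i p X - Defs.contract (Gamma i p) X) *m phi i p = 0.
    apply: (scalerI (a := 2^-1)); first by rewrite invr_eq0 pnatr_eq0.
    by rewrite -nablaE// Gnabla// scaler0.
  (* The difference lies in [su3] and is orthogonal to [su3], hence to itself, so it vanishes. *)
  have Dsu3 : su3 G (phi i p) (T i p X - Defs.contract (Gamma i p) X) by [].
  apply: form2_dot_skew_eq0 => //.
  by rewrite form2_dotBr Tp// Gp// subrr.
(* Conversely, the formula for all [Y] and [Z] determines the matrix of [Gamma(X)], so each defining
   property can be read off from [T]. *)
have GT i p X : dom i p -> Defs.contract (Gamma i p) X = T i p X.
  move=> dip; apply: dotv_mulmx_inj => Y Z.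
  rewrite -/(eval3 _ X Y Z) GE// (torsionE hphi S eta X Y Z hJ dip).
  by rewrite spinor_formE.
split=> [|i p X dip|i p X dip]; first split=> [i a|i k p X Y Z dip dkp].
- apply: smooth_mx_eq_on (torsion_smooth hphi hSeta i a).
    exact: coord_open.
  by move=> _ [p dip <-] /=; rewrite coordK// -[RHS]contract_delta GT.
- rewrite !GE// !(torsionE hphi S eta _ _ _ hJ)//.
  by rewrite (torsion_transition hphi hSeta _ _ _ dip dkp).
- by rewrite GT.
- by rewrite nablaE// GT// subrr raddf0 mul0mx scaler0.
Qed.
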